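(* The Borel hierarchy and the Luzin hierarchy of $\mathrm{QCB}_0$-spaces do not collapse. More precisely, $\mathrm{QCB}_0(\mathbf{\Sigma}^0_\alpha)\not\subseteq \mathrm{QCB}_0(\mathbf{\Pi}^0_\alpha)$ for each countable ordinal $\alpha\geq 2$, and $\mathrm{QCB}_0(\mathbf{\Sigma}^1_n)\not\subseteq \mathrm{QCB}_0(\mathbf{\Pi}^1_n)$ for each positive integer $n$.
   Context: $\mathcal N$ denotes the Baire space. A representation of a space $X$ is a surjection $\delta$ from a subspace of $\mathcal N$ onto $X$; it is admissible if it is continuous and every continuous function from a zero-dimensional countably based $T_0$-space to $X$ factors as $\delta g$ with $g$ continuous. $\mathrm{QCB}_0$-spaces are $T_0$-quotients of countably based spaces (equivalently, admissibly representable sequential spaces). For a representation $\delta$, $EQ(\delta)=\{(p,q)\in\mathcal N^2\mid p,q\in\mathrm{dom}(\delta),\ \delta(p)=\delta(q)\}$. For a family of pointclasses $\Gamma$ (e.g. levels $\mathbf{\Sigma}^0_\alpha,\mathbf{\Pi}^0_\alpha$ of the Borel hierarchy — defined for arbitrary spaces with $\mathbf{\Sigma}^0_2$ = countable unions of differences of open sets — and levels $\mathbf{\Sigma}^1_n,\mathbf{\Pi}^1_n$ of the Luzin hierarchy, where $\mathbf{\Sigma}^1_1(X)$ = projections along $\mathcal N$ of $\mathbf{\Pi}^0_2(\mathcal N\times X)$-sets), a space $X$ is $\Gamma$-representable if it has an admissible representation $\delta$ with $EQ(\delta)\in\Gamma(\mathcal N\times\mathcal N)$; $\mathrm{QCB}_0(\Gamma)$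 denotes the class of all $\Gamma$-representable spaces. *)

(* Defs.v *)
From HB Require Import structures.
From mathcomp Require Import all_boot all_order.
From mathcomp Require Import all_classical topology.

Set Implicit Arguments.
Unset Strict Implicit.
Unset Printing Implicit Defensive.

Local Open Scope classical_set_scope.
Local Open Scope card_scope.

Definition baire_space : Type := prod_topology (fun _ : nat => nat).

HB.instance Definition _ := Pointed.on baire_space.
HB.instance Definition _ := Topological.on baire_space.

Definition pointclass := forall T : topologicalType, set (set T).

Definition complement_class (G : pointclass) : pointclass :=
  fun T A => G T (~` A).

Definition Sigma02 : pointclass := fun T A =>
  exists U V : nat -> set T,
    [/\ forall n, open (U n), forall n, open (V n)
      & A = \bigcup_n (U n `\` V n)].

(* An ordinal is given as an element [a] of a well-ordered type [W]: it is the
   order type of [below a], and the ordinals smaller than it are the [b < a].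
   In particular it is the finite ordinal n iff [below a] has n elements. *)
Definition below (d : Order.disp_t) (W : orderType d) (a : W) : set W :=
  [set b | (b < a)%O].

(* The levels start at 1: no set is in the family indexed by the ordinal 0. *)
Inductive is_Sigma0 (d : Order.disp_t) (W : orderType d) (T : topologicalType)
    : W -> set T -> Prop :=
| is_Sigma0_1 (a : W) (A : set T) :
    below a #= `I_1 -> open A -> is_Sigma0 a A
| is_Sigma0_2 (a : W) (A : set T) :
    below a #= `I_2 -> Sigma02 A -> is_Sigma0 a A
| is_Sigma0_gt2 (a : W) (A : set T) (b : nat -> W) (B : nat -> set T) :
    `I_3 #<= below a ->
    (forall n, (b n < a)%O) ->
    (forall n, is_Sigma0 (b n) (~` B n)) ->
    A = \bigcup_n B n ->
    is_Sigma0 a A.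

Definition Sigma0 (d : Order.disp_t) (W : orderType d) (a : W) : pointclass :=
  fun T => @is_Sigma0 d W T a.

Definition Pi0 (d : Order.disp_t) (W : orderType d) (a : W) : pointclass :=
  complement_class (Sigma0 a).

(* With [Sigma1 0] taken to be Sigma^0_2, one clause gives both
   Sigma^1_1 = projections of Pi^0_2-sets and
   Sigma^1_{n+1} = projections of Pi^1_n-sets. *)
Fixpoint Sigma1 (n : nat) : pointclass :=
  if n is m.+1 then fun T A =>
    exists2 B : set (baire_space * T),
      complement_class (Sigma1 m) B & A = snd @` B
  else Sigma02.

Definition Pi1 (n : nat) : pointclass := complement_class (Sigma1 n).

(* [zero_dimensional] of MathComp-Analysis only asks that distinct points be
   separated by clopen sets, which is weaker than having a clopen basis. *)
Definition has_clopen_basis (Z : topologicalType) := basis (@clopen Z).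

(* A representation of [X] has domain a subset [D] of the Baire space, which
   carries the subspace topology as [set_type D]. *)
Definition representation (X : topologicalType) (D : set baire_space)
    (delta : D -> X) :=
  range delta = [set: X].

Definition admissible (X : topologicalType) (D : set baire_space)
    (delta : D -> X) :=
  [/\ representation delta,
      continuous delta
    & forall (Z : topologicalType) (f : Z -> X),
        has_clopen_basis Z -> @second_countable Z -> kolmogorov_space Z ->
        continuous f ->
        exists2 g : Z -> D, continuous g & f = delta \o g].

Definition EQ (X : topologicalType) (D : set baire_space) (delta : D -> X)
    : set (baire_space * baire_space) :=
  [set pq | exists p q : D,
    pq = (set_val p, set_val q) /\ delta p = delta q].

Definition representable (G : pointclass) (X : topologicalType) :=
  exists (D : set baire_space) (delta : D -> X),
    admissible delta /\ G _ (EQ delta).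

Definition quotient_map (Y X : topologicalType) (q : Y -> X) :=
  range q = [set: X] /\ forall U : set X, open U <-> open (q @^-1` U).

Definition QCB0_space (X : topologicalType) :=
  kolmogorov_space X /\
  exists (Y : topologicalType) (q : Y -> X),
    @second_countable Y /\ quotient_map q.

Definition QCB0 (G : pointclass) (X : topologicalType) :=
  QCB0_space X /\ representable G X.

(* Main.v *)
Require Import Defs.
From HB Require Import structures.
From mathcomp Require Import all_boot all_order.
From mathcomp Require Import all_classical topology.

(* A subset A of the Baire space is itself a QCB0-space, and the identity of A
   is an admissible representation whose EQ is the diagonal over A; so A in
   Sigma gives A in QCB0(Sigma).  Conversely, let delta be an admissible
   representation of A with EQ(delta) in Pi.  The identity of A factors as
   delta \o g; extend g to F, continuous on a Pi^0_2-set S between A and its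
   closure.  If x is in S and F x is in dom(delta), then delta (F x) = x, since x
   is a limit of points a of A with delta (g a) = a; hence
   A = {x in S | (F x, F x) in EQ(delta)}, which is in Pi.  The hierarchies of
   QCB0-spaces therefore separate as soon as those of subsets of the Baire space
   do, and the latter follows from universal sets by diagonalization. *)

Set Implicit Arguments.
Unset Strict Implicit.
Unset Printing Implicit Defensive.

Import Order.TTheory.

Local Open Scope classical_set_scope.
Local Open Scope card_scope.

(** * Relative continuity, and continuity into the Baire space by coordinates *)

Lemma within_continuous_open (Y T : topologicalType) (S : set Y) (h : Y -> T)
    (U : set T) :
  {within S, continuous h} -> open U ->
  exists2 V : set Y, open V & S `&` h @^-1` U = S `&` V.
Proof.
move=> /continuousP hc /hc oU; have /open_subspaceP[V oV VE] := oU.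
by exists V => //; rewrite setIC [RHS]setIC VE.
Qed.

Lemma within_continuous_pair (Z Y T : topologicalType) (S : set Y) (h : Y -> T) :
  {within S, continuous h} ->
  {within snd @^-1` S, continuous (fun z : Z * Y => (z.1, h z.2))}.
Proof.
move=> /subspace_continuousP hc; apply/subspace_continuousP => -[p y] /= Sy.
move=> U [[P Q] [/= nP nQ] PQU].
have nS := hc y Sy Q nQ.
exists (P, [set z | S z -> Q (h z)]) => //=.
by move=> [q z] /= [Pq Sz] Sz'; apply: PQU; split => //=; exact: Sz.
Qed.

Lemma continuous_id (T : topologicalType) : continuous (@id T).
Proof. by move=> x; exact: cvg_id. Qed.

Lemma fst_continuous (T U : topologicalType) : continuous (@fst T U).
Proof. by move=> ?; exact: cvg_fst. Qed.

Lemma snd_continuous (T U : topologicalType) : continuous (@snd T U).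
Proof. by move=> ?; exact: cvg_snd. Qed.

Lemma continuous_pair (Z Y T : topologicalType) (f : Z -> Y) (g : Z -> T) :
  continuous f -> continuous g -> continuous (fun z => (f z, g z)).
Proof. by move=> cf cg z; apply: cvg_pair; [exact: cf|exact: cg]. Qed.

Lemma open_snd_preimage (T U : topologicalType) (V : set U) :
  open V -> open [set z : T * U | V z.2].
Proof. by move=> oV; have /continuousP := @snd_continuous T U; exact. Qed.

Lemma baire_cvg (T : Type) (F : set_system T) (f : T -> baire_space)
    (p : baire_space) :
  Filter F -> (forall n, (fun x => f x n) @ F --> p n) -> f @ F --> p.
Proof.
move=> FF fp; apply/cvg_sup => n U [V [[W oW <-] /= Wx] WU].
exact: (filterS WU (fp n W (open_nbhs_nbhs (conj oW Wx)))).
Qed.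

Lemma baire_continuous (T : topologicalType) (f : T -> baire_space) :
  (forall n, continuous (fun x => f x n)) -> continuous f.
Proof.
by move=> fc x; apply: baire_cvg => n; exact: fc.
Qed.

Lemma baire_coord_continuous n : continuous (fun p : baire_space => p n).
Proof. exact: (@proj_continuous nat (fun=> nat) n). Qed.

Lemma baire_coord_open (T : topologicalType) (f : T -> baire_space) n
    (P : set nat) : continuous f -> open [set x | P (f x n)].
Proof.
move=> fc; have /continuousP : continuous (fun x => f x n).
  by move=> x; exact: continuous_comp (fc x) (@baire_coord_continuous n (f x)).
by apply; exact: discrete_open.
Qed.

Lemma coord_open n (P : set nat) : open [set p : baire_space | P (p n)].
Proof. by apply: (@baire_coord_open _ id) => x; exact: cvg_id. Qed.

Lemma coord_fst_open (T : topologicalType) n (P : set nat) :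
  open [set z : baire_space * T | P (z.1 n)].
Proof. exact: baire_coord_open (@fst_continuous _ _). Qed.

(** * Closure properties of Sigma^0_2 in arbitrary spaces *)

Section Sigma02_closure.
Context {T : topologicalType}.
Implicit Types A B U V : set T.

(** Numbers that decode to no index contribute an empty piece, so sums and products of index types
    may be used in place of [nat]. *)
Lemma Sigma02_bigcup (I : countType) (U V : I -> set T) :
  (forall i, open (U i)) -> (forall i, open (V i)) ->
  Sigma02 (\bigcup_i (U i `\` V i)).
Proof.
move=> oU oV.
exists (fun n => if unpickle n is Some i then U i else set0),
       (fun n => if unpickle n is Some i then V i else set0); split.
- by move=> n; case: unpickle => // *; exact: open0.
- by move=> n; case: unpickle => // *; exact: open0.
- rewrite predeqE => x; split=> [[i _ xi]|[n _]].
    by exists (pickle i) => //; rewrite pickleK.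
  by case: (unpickle n) => [i xi|[]//]; exists i.
Qed.

Lemma Sigma02_setD U V : open U -> open V -> Sigma02 (U `\` V).
Proof.
move=> oU oV; have -> : U `\` V = \bigcup_(_ : unit) (U `\` V).
  by rewrite bigcup_const//; exists tt.
exact: Sigma02_bigcup.
Qed.

Lemma Sigma02_open U : open U -> Sigma02 U.
Proof. by move=> oU; rewrite -[U]setD0; apply: Sigma02_setD => //; exact: open0. Qed.

Lemma Sigma02_closed A : open (~` A) -> Sigma02 A.
Proof.
by move=> oA; rewrite -[A]setCK -setTD; apply: Sigma02_setD => //; exact: openT.
Qed.

Lemma Sigma02U A B : Sigma02 A -> Sigma02 B -> Sigma02 (A `|` B).
Proof.
move=> [U [V [oU oV ->]]] [U' [V' [oU' oV' ->]]].
pose u (i : nat + nat) := match i with inl n => U n | inr n => U' n end.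
pose v (i : nat + nat) := match i with inl n => V n | inr n => V' n end.
suff -> : \bigcup_n (U n `\` V n) `|` \bigcup_n (U' n `\` V' n) =
    \bigcup_i (u i `\` v i).
  by apply: Sigma02_bigcup => -[].
rewrite predeqE => x; split=> [[] [n _ xn]|[[] n _ xn]].
- by exists (inl n).
- by exists (inr n).
- by left; exists n.
- by right; exists n.
Qed.

Lemma Sigma02I A B : Sigma02 A -> Sigma02 B -> Sigma02 (A `&` B).
Proof.
move=> [U [V [oU oV ->]]] [U' [V' [oU' oV' ->]]].
suff -> : \bigcup_n (U n `\` V n) `&` \bigcup_n (U' n `\` V' n) =
    \bigcup_(i : nat * nat) ((U i.1 `&` U' i.2) `\` (V i.1 `|` V' i.2)).
  by apply: Sigma02_bigcup => -[n m] /=; [exact: openI|exact: openU].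
rewrite predeqE => x; split=> [[[n _ [Un Vn]] [m _ [Um Vm]]]|].
  by exists (n, m) => //; split => // -[].
move=> [[n m] _ [[/= Un Um] nV]]; split; [exists n|exists m] => //.
  by split => // Vn; apply: nV; left.
by split => // Vm; apply: nV; right.
Qed.

(** The complement is closed union open. This lets differences of open sets serve as pieces of
    unions at levels above 2. *)
Lemma Sigma02_setC_setD U V : open U -> open V -> Sigma02 (~` (U `\` V)).
Proof.
move=> oU oV; rewrite setCD.
apply: Sigma02U; last exact: Sigma02_open.
by apply: Sigma02_closed; rewrite setCK.
Qed.

End Sigma02_closure.

(** * Preimages, and the Luzin hierarchy combined with Sigma^0_2 sets *)

(** The form is relative to a set [S], itself not assumed in the class, because the extension of a
    continuous map will be continuous only on a Pi^0_2 set. *)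
Definition preimage_closed (G : pointclass) :=
  forall (Y T : topologicalType) (S : set Y) (h : Y -> T) (B : set T),
    {within S, continuous h} -> G T B ->
    exists2 A : set Y, G Y A & S `&` h @^-1` B = S `&` A.

Lemma preimage_closed_continuous G (Y T : topologicalType) (h : Y -> T)
    (B : set T) :
  preimage_closed G -> continuous h -> G T B -> G Y (h @^-1` B).
Proof.
move=> Gp hc GB.
have [A GA] := Gp _ _ _ _ _ (continuous_subspaceT (A := setT) hc) GB.
by rewrite !setTI => ->.
Qed.

Lemma Sigma02_preimage : preimage_closed Sigma02.
Proof.
move=> Y T S h B hc [U [V [oU oV ->]]].
have /choice[U' U'P] n : exists U', open U' /\ S `&` h @^-1` (U n) = S `&` U'.
  by have [U' ? ?] := within_continuous_open hc (oU n); exists U'.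
have /choice[V' V'P] n : exists V', open V' /\ S `&` h @^-1` (V n) = S `&` V'.
  by have [V' ? ?] := within_continuous_open hc (oV n); exists V'.
exists (\bigcup_n (U' n `\` V' n)).
  by apply: Sigma02_bigcup => n; [have [] := U'P n|have [] := V'P n].
have UE n y : S y -> U n (h y) <-> U' n y.
  move=> Sy; have [_ /predeqP/(_ y) [E1 E2]] := U'P n.
  by split=> Uy; [case: E1|case: E2].
have VE n y : S y -> V n (h y) <-> V' n y.
  move=> Sy; have [_ /predeqP/(_ y) [E1 E2]] := V'P n.
  by split=> Uy; [case: E1|case: E2].
rewrite predeqE => y; split=> -[Sy [n _ [Un Vn]]]; split=> //; exists n => //.
  by split; [exact/UE|move/VE; auto].
by split; [exact/UE|move/VE; auto].
Qed.

(** Projection commutes with preimage: pull the witness set back along the identity times [h],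
    relative to the pairs with second component in [S], and project again. *)
Lemma Sigma1_preimage n : preimage_closed (Sigma1 n).
Proof.
elim: n => [|n IHn]; first exact: Sigma02_preimage.
move=> Y T S h B hc [C CC ->].
have [A SA AE] := IHn _ _ _ _ _ (within_continuous_pair (Z := baire_space) hc) CC.
exists (snd @` (~` A)); first by exists (~` A) => //; rewrite /complement_class setCK.
have {}AE p y : S y -> ~ C (p, h y) <-> A (p, y).
  move=> Sy; move/predeqP: AE => /(_ (p, y)) [E1 E2].
  by split=> ?; [case: E1|case: E2].
rewrite predeqE => y; split=> -[Sy].
  move=> [[p z] /= Cpz zE]; split=> //; exists (p, y) => //= /AE.
  by rewrite -zE; apply.
move=> [[p z] /= nA zy]; split=> //=; exists (p, h y) => //.
by apply: contrapT => nC; apply: nA; rewrite zy; apply/AE.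
Qed.

Definition shift (p : baire_space) : baire_space := fun n => p n.+1.

Lemma shift_continuous : continuous shift.
Proof. by apply: baire_continuous => n; exact: baire_coord_continuous. Qed.

(* For both operations the head of the witness selects the piece of the Sigma^0_2 set
   (or the projection, for the union) and its tail is the witness for A. *)
Lemma Sigma1UI_Sigma02 n (T : topologicalType) (A Q : set T) :
  Sigma1 n A -> Sigma02 Q -> Sigma1 n (A `|` Q) /\ Sigma1 n (A `&` Q).
Proof.
elim: n T A Q => [|n IHn] T A Q SA SQ; first by split; [exact: Sigma02U|exact: Sigma02I].
have [B SB AE] := SA; have [U [V [oU oV QE]]] := SQ.
have hc : continuous (fun z : baire_space * T => (shift z.1, z.2)).
  apply: continuous_pair (@snd_continuous _ _) => z.
  by apply: continuous_comp; [exact: fst_continuous|exact: shift_continuous].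
have SB' := preimage_closed_continuous (@Sigma1_preimage n) hc SB.
(* [f] decodes the head. For the union it will be [pr], where 0 selects [A] and k+1 the piece k; for
   the intersection it will be [Some], where every head selects a piece. *)
pose Qn (f : nat -> option nat) := [set z : baire_space * T |
  exists2 k, f (z.1 0) = Some k & (U k `\` V k) z.2].
have SQn f : Sigma02 (~` Qn f).
  have -> : Qn f = [set z | exists2 k, f (z.1 0) = Some k & U k z.2] `\`
                 [set z | exists2 k, f (z.1 0) = Some k & V k z.2].
    rewrite predeqE => z; split=> [[k fk [Uk Vk]]|[[k fk Uk] nV]].
      by split; [exists k|move=> [k']; rewrite fk => -[<-]].
    by exists k => //; split=> // Vk; apply: nV; exists k.
  have oQ (W : nat -> set T) : (forall k, open (W k)) ->
      open [set z : baire_space * T | exists2 k, f (z.1 0) = Some k & W k z.2].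
    move=> oW; rewrite (_ : [set _ | _] = \bigcup_k
      ([set z | f (z.1 0) = Some k] `&` [set z | W k z.2])); last first.
      by rewrite predeqE => z; split=> -[k] => [? ?|_ [? ?]]; exists k.
    apply: bigcup_open => k _; apply: openI; last exact: open_snd_preimage.
    exact: (@coord_fst_open T 0 [set m | f m = Some k]).
  by apply: Sigma02_setC_setD; exact: oQ.
split.
- have oN : open [set z : baire_space * T | z.1 0 != 0].
    exact: (@coord_fst_open T 0 [set m | m != 0]).
  pose pr m := if m is k.+1 then Some k else None.
  (* This is the complement of the witness set. Forming it takes a union and an intersection at
     level [n], hence the joint induction. *)
  have SD := (IHn _ _ _ (IHn _ _ _ SB' (Sigma02_open oN)).1 (SQn pr)).2.
  eexists; first by rewrite /complement_class; erewrite setCK; exact: SD.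
  rewrite AE QE predeqE => x; split=> [[[[p y] /= Bp <-]|[k _ Qk]]|].
  + exists ((fun n => if n is m.+1 then p m else 0), y) => //= -[[]//]; exact.
  + exists ((fun n => k.+1), x) => //= -[_]; apply; by exists k.
  + move=> [[p y] /= nD <-]; apply: contrapT => nBQ; apply: nD; split.
      have [p0|] := eqVneq (p 0) 0; [left => Bp|by right].
      by apply: nBQ; left; exists (shift p, y).
    move=> [[|k] /= prk Qk]; apply: nBQ; right; [by exists 0|by exists k.+1].
- have SD := (IHn _ _ _ SB' (SQn Some)).1.
  eexists; first by rewrite /complement_class; erewrite setCK; exact: SD.
  rewrite AE QE predeqE => x; split=> [[[[p y] /= Bp <-] [k _ Qk]]|].
    exists ((fun n => if n is m.+1 then p m else k), y) => //= -[/=|].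
      by apply; rewrite /shift/=.
    by apply; exists k.
  move=> [[p y] /= nD <-].
  have [/= /contrapT Bp /contrapT [k _ Qk]] : ~ (~ B (shift p, y)) /\ ~ ~ Qn Some (p, y).
    by split=> ?; apply: nD; [left|right].
  by split; [exists (shift p, y)|exists k].
Qed.

(** * Cylinders and countable bases *)

Lemma basisP (T : topologicalType) (B : set (set T)) :
  basis B <-> B `<=` open /\
    forall U x, open U -> U x -> exists V, [/\ B V, V x & V `<=` U].
Proof.
split=> -[Bo Bx]; split=> //.
  move=> U x oU Ux.
  by have [V [BV Vx] VU] := Bx x _ (open_nbhs_nbhs (conj oU Ux)); exists V.
move=> x U; rewrite nbhsE => -[V [oV Vx] VU].
have [W [BW Wx WV]] := Bx V x oV Vx.
by exists W => //; exact: subset_trans VU.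
Qed.

Definition cylinder (s : seq nat) : set baire_space :=
  [set p | forall i, i < size s -> p i = nth 0 s i].

Lemma cylinder_open s : open (cylinder s).
Proof.
elim/last_ind: s => [|s a os].
  by rewrite (_ : cylinder _ = setT); [exact: openT|rewrite predeqE].
rewrite (_ : cylinder _ = cylinder s `&` [set p | p (size s) = a]).
  apply: openI; first exact: os.
  exact: (coord_open _ [set m | m = a]).

rewrite predeqE /cylinder /= size_rcons => p.
split=> [ps|[ps pa] i].
  split=> [i si|]; last by rewrite ps // nth_rcons ltnn eqxx.
  by rewrite ps ?nth_rcons ?si // ltnS ltnW.
rewrite ltnS nth_rcons leq_eqVlt => /predU1P[->|si].
  by rewrite ltnn eqxx.
by rewrite si ps.
Qed.

(** A point outside the cylinder of [s] lies in that of its own prefix of the same length, so the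
    complement is a union of cylinders. *)
Lemma cylinder_clopen s : clopen (cylinder s).
Proof.
split; first exact: cylinder_open.
rewrite -openC; suff -> : ~` cylinder s =
    \bigcup_(t in [set t | size t = size s /\ t != s]) cylinder t.
  by apply: bigcup_open => t _; exact: cylinder_open.
rewrite predeqE => p; split=> [ps|[t [ts tNs] pt] ps].
  exists (mkseq p (size s)); last by move=> i; rewrite size_mkseq => si; rewrite nth_mkseq.
  rewrite /= size_mkseq; split=> //; apply/eqP => sE; apply: ps => i si.
  by rewrite -sE nth_mkseq.
move/eqP: tNs; apply; apply: (@eq_from_nth _ 0) => // i ti.
by rewrite -pt // ps // -ts.
Qed.

(** The filter generated by the cylinders around [p] converges to [p] because it does so in each
    coordinate: fixing a prefix of length n+1 fixes coordinate n. *)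
Lemma cylinder_basis : basis (range cylinder).
Proof.
split; first by move=> _ [s _ <-]; exact: cylinder_open.
move=> p.
have cN n : filter_from [set U | range cylinder U /\ U p] id (cylinder (mkseq p n)).
  exists (cylinder (mkseq p n)) => //; split=> // i; rewrite size_mkseq => ni.
  by rewrite nth_mkseq.
have FF : Filter (filter_from [set U | range cylinder U /\ U p] id).
  apply: filter_from_filter; first by have [U ? _] := cN 0; exists U.
  move=> _ _ [[s _ <-] ps] [[t _ <-] pt].
  exists (cylinder (mkseq p (maxn (size s) (size t)))).
    split=> // i; rewrite size_mkseq => ni; by rewrite nth_mkseq.
  move=> q; rewrite /cylinder /= size_mkseq => qp; split=> i si.
    have im : i < maxn (size s) (size t) by rewrite leq_max si.
    by rewrite qp // nth_mkseq // ps.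
  have im : i < maxn (size s) (size t) by rewrite leq_max si orbT.
  by rewrite qp // nth_mkseq // pt.
apply: (@baire_cvg _ _ id p FF) => n; apply: cvg_near_cst.
apply: filterS (cN n.+1) => q qp; rewrite qp ?size_mkseq ?nth_mkseq //.
Qed.

Lemma baire_second_countable : @second_countable baire_space.
Proof.
exists (range cylinder); last exact: cylinder_basis.
exact: (sub_countable (card_image_le _ _) (countableP _)).
Qed.

Lemma second_countable_prod (T U : topologicalType) :
  @second_countable T -> @second_countable U -> @second_countable (T * U)%type.
Proof.
move=> [B cB /basisP[oB bB]] [C cC /basisP[oC bC]].
exists ((fun VW => VW.1 `*` VW.2) @` (B `*` C)).
  exact: (sub_countable (card_image_le _ _) (countableX cB cC)).
split.
  move=> _ [[V W] [/= BV CW] <-]; rewrite openE => -[x y] [/= Vx Wy].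
  by exists (V, W) => //=; split; apply: open_nbhs_nbhs; split; auto.
move=> [x y] U' [[P Q]] /= [].
rewrite !nbhsE => -[P' [oP' Px] PP] [Q' [oQ' Qy] QQ] PQ.
have [V [BV Vx VP]] := bB _ _ oP' Px; have [W [CW Wy WQ]] := bC _ _ oQ' Qy.
exists (V `*` W); first by split=> //; exists (V, W).
by move=> [a b] [/= Va Wb]; apply: PQ; split; [apply/PP/VP|apply/QQ/WQ].
Qed.

(** * Subspaces of the Baire space: countably based, zero-dimensional and T0 *)

Section subspace_of_baire.
Context (A : set baire_space).

Definition subcylinder (s : seq nat) : set (set_type A) := set_val @^-1` cylinder s.

Lemma set_val_continuous (T : topologicalType) (B : set T) :
  continuous (set_val : set_type B -> T).
Proof. exact: initial_continuous. Qed.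

Lemma subcylinder_basis : basis (range subcylinder).
Proof.
apply/basisP; split.
  move=> _ [s _ <-]; have /continuousP := @set_val_continuous _ A; apply.
  exact: cylinder_open.
move=> _ x [V oV <-] Vx; have /basisP[_ cb] := cylinder_basis.
have [_ [[s _ <-] xs sV]] := cb _ _ oV Vx.
by exists (subcylinder s); split=> // y; exact: sV.
Qed.

Lemma sub_second_countable : @second_countable (set_type A).
Proof.
exists (range subcylinder); last exact: subcylinder_basis.
exact: (sub_countable (card_image_le _ _) (countableP _)).
Qed.

Lemma sub_has_clopen_basis : has_clopen_basis (set_type A).
Proof.
have /basisP[_ cb] := subcylinder_basis.
apply/basisP; split; first by move=> ? [].
move=> U x oU Ux; have [_ [[s _ <-] xs sV]] := cb _ _ oU Ux.
exists (subcylinder s); split=> //; apply: preimage_clopen.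
  exact: cylinder_clopen.
exact: set_val_continuous.
Qed.

Lemma sub_kolmogorov : kolmogorov_space (set_type A).
Proof.
apply: accessible_kolmogorov => x y /eqP xy.
have [n xyn] : exists n, set_val x n <> set_val y n.
  apply/existsNP => xyE; apply: xy; apply: val_inj.
  exact: functional_extensionality_dep.
exists [set z : A | set_val z n = set_val x n]; split.
- exact: (@baire_coord_open _ _ n [set m | m = set_val x n] (@set_val_continuous _ A)).
- by rewrite inE.
- by rewrite inE /= => yx; exact: (xyn (esym yx)).
Qed.

End subspace_of_baire.

(** * Extension of a continuous map to a Pi^0_2 set *)

Section extension.
Context {Y : topologicalType} (A : set Y) (g : A -> baire_space).
Hypothesis gc : continuous g.

(* The points of closure A lying in every O n are those at which g has zero
   oscillation. *)
Let O n : set Y := \bigcup_(V in [set V | open V /\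
  forall a b : A, V (set_val a) -> V (set_val b) -> g a n = g b n]) V.

(** Close enough to a point of [S], all values [g a n] agree, and some such [a] exists because the
    point is in the closure of [A]; their common value is coordinate n of [F]. *)
Lemma continuous_extension : exists (S : set Y) (F : Y -> baire_space),
  [/\ Sigma02 (~` S), A `<=` S, S `<=` closure A,
      {within S, continuous F} & forall a : A, F (set_val a) = g a].
Proof.
have oO n : open (O n) by apply: bigcup_open => V [].
pose S := closure A `&` \bigcap_n O n.
have AS : A `<=` S.
  move=> y Ay; split; first exact: subset_closure.
  move=> n _; pose a : A := SigSub (mem_set Ay).
  have := @baire_coord_open _ _ n [set m | m = g a n] gc.
  move=> -[V oV VE]; exists V.
    have VgE (b : A) : V (set_val b) -> g b n = g a n.
      by move=> Vb; have : (set_val @^-1` V) b by []; rewrite VE.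
    by split=> // b c /VgE -> /VgE ->.
  suff : (set_val @^-1` V) a by [].
  by rewrite VE.
(* Off [S] the value is an arbitrary 0. *)
have /choice[F0 F0P] (yn : Y * nat) : exists k, S yn.1 -> exists V,
    [/\ open V, V yn.1 & forall a : A, V (set_val a) -> g a yn.2 = k].
  case: yn => y n /=.
  have [[cy Oy]|nS] := pselect (S y); last by exists 0.
  have [V [oV VE] Vy] := Oy n I.
  have [z [Az Vz]] := cy V (open_nbhs_nbhs (conj oV Vy)).
  exists (g (SigSub (mem_set Az)) n) => _.
  by exists V; split=> // a Va; exact: VE.
pose F y : baire_space := fun n => F0 (y, n).
exists S, F; split => //.
- rewrite setCI setC_bigcap; apply: Sigma02U.
    by apply/Sigma02_open; rewrite openC; exact: closed_closure.
  under eq_bigcupr do rewrite -setTD.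
  by apply: Sigma02_bigcup => // n; exact: openT.
- by move=> y [].
- apply/subspace_continuousP => y Sy; apply: baire_cvg => n.
  apply: cvg_near_cst; have [V [oV Vy VE]] := F0P (y, n) Sy.
  have : nbhs y V by exact: open_nbhs_nbhs.
  apply: filterS => z Vz Sz; have [V' [oV' Vz' VE']] := F0P (z, n) Sz.
  (* A point of [A] in both neighbourhoods shows that [F] has the same coordinate n at [y] and
     [z]. *)
  have [w [Aw [Vw Vw']]] := Sz.1 (V `&` V') (open_nbhs_nbhs (conj (openI oV oV') (conj Vz Vz'))).
  pose a : A := SigSub (mem_set Aw).
  by rewrite /from_subspace /F -(VE a Vw) -(VE' a Vw').
- move=> a; apply: functional_extensionality_dep => n.
  have [V [_ Va VE]] := F0P (set_val a, n) (AS _ (set_mem (valP a))).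
  by rewrite /F (VE a).
Qed.

End extension.

(** * Diagonalization and the criterion for non-inclusion *)

Definition universal (G : pointclass) (T : topologicalType)
    (U : set (baire_space * T)) :=
  G _ U /\ forall A, G T A -> exists e, A = [set x | U (e, x)].

(** The diagonal section of [U] works: a code [e] of its complement would make [U (e, e)] equivalent
    to its negation. *)
Lemma universal_diagonal G (U : set (baire_space * baire_space)) :
  preimage_closed G -> universal G U ->
  exists2 A : set baire_space, G _ A & ~ G _ (~` A).
Proof.
move=> Gp [GU Uu]; exists ((fun x => (x, x)) @^-1` U).
  by apply: preimage_closed_continuous => //; apply: continuous_pair => x; exact: cvg_id.
move=> /Uu[e /predeqP/(_ e) /= [E1 E2]].
have nU : ~ U (e, e) by move=> Ue; exact: (E2 Ue).
exact: nU (E1 nU).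
Qed.

Lemma diagonal_open : open (~` [set z : baire_space * baire_space | z.1 = z.2]).
Proof.
rewrite (_ : ~` _ = \bigcup_(nij in [set nij : nat * (nat * nat) | nij.2.1 != nij.2.2])
   ([set z | z.1 nij.1 = nij.2.1] `&` [set z | z.2 nij.1 = nij.2.2])).
  apply: bigcup_open => -[n [i j]] _ /=; apply: openI.
    exact: (@baire_coord_open _ _ n [set m | m = i] (@fst_continuous _ _)).
  exact: (@baire_coord_open _ _ n [set m | m = j] (@snd_continuous _ _)).
rewrite predeqE => -[p q]; split=> /= [pq|[[n [i j]] /= ij [pi qj]] pq]; last first.
  by move: ij; rewrite -pi -qj pq eqxx.
have [n pqn] : exists n, p n <> q n.
  by apply/existsNP => pqE; apply: pq; exact: functional_extensionality_dep.
by exists (n, (p n, q n)) => //=; apply/eqP.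
Qed.

Lemma representable_complement G (A : set baire_space) :
  preimage_closed G ->
  (forall B Q : set baire_space, G _ B -> Sigma02 Q -> G _ (B `|` Q)) ->
  representable (complement_class G) (set_type A) -> G _ (~` A).
Proof.
move=> Gp GU [D [delta [[_ dc dadm] GE]]].
have [g gc gE] := dadm _ id (@sub_has_clopen_basis A) (@sub_second_countable A)
  (@sub_kolmogorov A) (@continuous_id _).
have vgc : continuous (set_val \o g : A -> baire_space).
  by move=> x; exact: continuous_comp (gc x) (@set_val_continuous _ D (g x)).
have [S [F [S02 AS SA Fc FE]]] := continuous_extension vgc.
have hc : {within S, continuous (fun x => (F x, F x))}.
  by move=> x; exact: cvg_pair (Fc x) (Fc x).
have [A' GA' A'E] := Gp _ _ _ _ _ hc GE.
(* On [S], the set [A'] consists of the [x] with [(F x, F x)] outside [EQ delta]; no point outside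
   [S] is in [A]. *)
suff -> : ~` A = A' `|` ~` S by exact: GU.
have inA x : S x -> EQ delta (F x, F x) -> A x.
  move=> Sx [p [_ [[Fp _] _]]].
  suff -> : x = set_val (delta p) by exact: (set_mem (valP (delta p))).
  apply: functional_extensionality_dep => n; apply: contrapT => xn.
  have vdc : continuous (set_val \o delta : D -> baire_space).
    by move=> q; exact: continuous_comp (dc q) (@set_val_continuous _ A (delta q)).
  (* On [V], coordinate n of [delta] is that of [delta p]. A point [z] of [A] near [x] has
     [z n = x n] and [F z] in [V], and there [delta (g z) = z]; so [x] and [delta p] agree at
     [n]. *)
  have [V oV VE] := @baire_coord_open _ _ n [set m | m = set_val (delta p) n] vdc.
  have Vp : V (F x) by rewrite Fp; suff : (set_val @^-1` V) p by []; rewrite VE.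
  have nV : nbhs (F x) V by exact: open_nbhs_nbhs.
  have nx : nbhs x [set z | S z -> V (F z)].
    by have /subspace_continuousP/(_ x Sx V nV) := Fc.
  have nn : nbhs x [set z : baire_space | z n = x n].
    apply: open_nbhs_nbhs; split=> //.
    exact: (coord_open n [set m | m = x n]).
  have [z [Az [/= zV zn]]] := SA x Sx _ (filterI nx nn).
  pose a : A := SigSub (mem_set Az).
  have : V (F z) by apply: zV; exact: AS.
  rewrite -[z]/(set_val a) FE => Vg.
  have : (set_val @^-1` V) (g a) by [].
  rewrite VE /= => dg; apply: xn; rewrite -dg -zn.
  by have /= := congr1 (fun k => k a) gE => <-.
rewrite predeqE => x; split=> [nAx|].
  have [Sx|] := pselect (S x); last by right.
  left; suff : (S `&` A') x by case.
  by rewrite -A'E; split=> // /inA; auto.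
move=> [A'x|nS] Ax; last by apply: nS; exact: AS.
have : (S `&` A') x by split=> //; exact: AS.
rewrite -A'E => -[_]; apply; pose a : A := SigSub (mem_set Ax).
by exists (g a), (g a); rewrite -[x]/(set_val a) FE.
Qed.

Lemma representable_self G (A : set baire_space) :
  preimage_closed G ->
  (forall B C : set (baire_space * baire_space),
     G _ B -> open (~` C) -> G _ (B `&` C)) ->
  G _ A -> representable G (set_type A).
Proof.
move=> Gp GI GA; exists A, id; split.
  split; first by rewrite /representation image_id.
    by move=> x; exact: cvg_id.
  by move=> Z f _ _ _ fc; exists f.
rewrite (_ : EQ _ = (fst @^-1` A) `&` [set z | z.1 = z.2]).
  apply: GI diagonal_open; apply: preimage_closed_continuous => //.
  exact: fst_continuous.
rewrite predeqE => z; split=> [[p [_ [-> <-]]]|].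
  by split=> //; exact: (set_mem (valP p)).
case: z => x y [/= Ax <-].
by exists (SigSub (mem_set Ax)), (SigSub (mem_set Ax)).
Qed.

(** The criterion is common to both hierarchies. Unions with Sigma^0_2 sets absorb the points where
    the extension is undefined, and intersections with closed sets are for the diagonal. *)
Theorem QCB0_not_sub_complement G (U : set (baire_space * baire_space)) :
  preimage_closed G ->
  (forall B Q : set baire_space, G _ B -> Sigma02 Q -> G _ (B `|` Q)) ->
  (forall B C : set (baire_space * baire_space),
     G _ B -> open (~` C) -> G _ (B `&` C)) ->
  universal G U ->
  ~ (forall X : topologicalType, QCB0 G X -> QCB0 (complement_class G) X).
Proof.
move=> Gp GU GI /(universal_diagonal Gp)[A GA nGA] QQ.
apply: nGA; apply: (representable_complement Gp GU).
apply: (QQ (set_type A) _).2; split; last exact: (representable_self Gp GI GA).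
split; first exact: sub_kolmogorov.
exists (set_type A), id; split; first exact: sub_second_countable.
by split; first exact: image_id.
Qed.

(** * Coding of countable families, and universal sets for the Luzin hierarchy *)

Section columns.
Context {K : countType}.

(** Lets a single code carry codes for all pieces of a countable union. *)
Definition column (p : baire_space) (k : K) : baire_space :=
  fun n => p (pickle (k, n)).

Lemma column_continuous k : continuous (column^~ k).
Proof. by apply: baire_continuous => n; exact: baire_coord_continuous. Qed.

Lemma columns_surj (c : K -> baire_space) :
  exists p, forall k, column p k = c k.
Proof.
exists (fun m => if @unpickle (K * nat)%type m is Some kn then c kn.1 kn.2 else 0).
by move=> k; apply: functional_extensionality_dep => n; rewrite /column pickleK.
Qed.

Lemma column_pair_continuous (T : topologicalType) k :
  continuous (fun z : baire_space * T => (column z.1 k, z.2)).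
Proof.
apply: continuous_pair (@snd_continuous _ _) => z.
exact: continuous_comp (@fst_continuous _ _ z) (@column_continuous k z.1).
Qed.

End columns.

(** A code stands for the union of the basic open sets [b i] over the indices [i] where it is
    nonzero; [b i] is empty if [i] numbers no basic set. *)
Lemma universal_open (T : topologicalType) : @second_countable T ->
  exists U : set (baire_space * T),
    universal (fun T => [set A : set T | open A]) U.
Proof.
move=> [B /countable_injP[f finj] /basisP[Bo Bb]].
pose b i := \bigcup_(V in [set V | B V /\ f V = i]) V.
have ob i : open (b i) by apply: bigcup_open => V [/Bo].
have bf V : B V -> b (f V) = V.
  move=> BV; rewrite predeqE => x; split=> [[W [BW fW] Wx]|Vx]; last by exists V.
  by rewrite -(finj W V) // inE.
exists (\bigcup_i ([set z | z.1 i != 0] `&` [set z | b i z.2])); split.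
  apply: bigcup_open => i _; apply: openI; last exact: open_snd_preimage.
  exact: (@coord_fst_open T i [set m | m != 0]).
move=> A oA; exists (fun i => `[< b i `<=` A >] : nat).
rewrite predeqE => x; split=> [Ax|[i _ /= []]].
  have [V [BV Vx VA]] := Bb A x oA Ax.
  exists (f V) => //=; rewrite bf //; split=> //.
  by case: asboolP.
by case: asboolP => // bA _ /bA.
Qed.

Lemma universal_Sigma02 (T : topologicalType) : @second_countable T ->
  exists U : set (baire_space * T), universal Sigma02 U.
Proof.
move=> /universal_open[U [oU Uu]].
pose W (nb : nat * bool) := [set z : baire_space * T | U (column z.1 nb, z.2)].
have oW nb : open (W nb).
  by have /continuousP := @column_pair_continuous _ T nb; apply.
exists (\bigcup_n (W (n, true) `\` W (n, false))); split.
  exact: Sigma02_bigcup.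
move=> A [V [V' [oV oV' ->]]].
have /choice[e eP] (nb : nat * bool) : exists e,
    (if nb.2 then V nb.1 else V' nb.1) = [set x | U (e, x)].
  by apply: Uu => /=; case: nb.2.
have [p pe] := columns_surj e; exists p.
rewrite predeqE => x; split=> -[n _ xn]; exists n => //; move: xn.
  by have /= -> := eP (n, true); have /= -> := eP (n, false); rewrite /W /= !pe.
by have /= -> := eP (n, true); have /= -> := eP (n, false); rewrite /W /= !pe.
Qed.

(** Complementing a universal set for level [n] on the product of the Baire space with [T], then
    projecting, gives one for level n+1. The map [h] exchanges the code with the witness that is
    projected away. *)
Lemma universal_Sigma1 n (T : topologicalType) : @second_countable T ->
  exists U : set (baire_space * T), universal (Sigma1 n) U.
Proof.
elim: n T => [|n IHn] T cT; first exact: universal_Sigma02.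
have [U [SU Uu]] := IHn _ (second_countable_prod baire_second_countable cT).
pose h (z : baire_space * (baire_space * T)) := (z.2.1, (z.1, z.2.2)).
have hc : continuous h.
  apply: continuous_pair => [z|].
    exact: continuous_comp (@snd_continuous _ _ z) (@fst_continuous _ _ z.2).
  apply: continuous_pair => z; first exact: fst_continuous.
  exact: continuous_comp (@snd_continuous _ _ z) (@snd_continuous _ _ z.2).
exists (snd @` (~` (h @^-1` U))); split.
  exists (~` (h @^-1` U)) => //; rewrite /complement_class setCK.
  exact: preimage_closed_continuous (@Sigma1_preimage n) hc SU.
move=> A [B /Uu[e Be] ->]; exists e.
have {}Be z : B z <-> ~ U (e, z).
  by move/predeqP: Be => /(_ z) [E1 E2]; split=> [Bz /E2|nU]; [|apply: contrapT => /E1].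
rewrite predeqE => x; split=> [[[p y] /= /Be nU <-]|].
  by exists (p, (e, y)).
move=> [[p [e' y]] /= nU [ee <-]]; exists (p, y) => //=; apply/Be.
by rewrite -ee.
Qed.

Lemma Sigma1I_closed n (T : topologicalType) (B C : set T) :
  Sigma1 n B -> open (~` C) -> Sigma1 n (B `&` C).
Proof.
by move=> SB oC; apply: (Sigma1UI_Sigma02 SB _).2; exact: Sigma02_closed.
Qed.

(** * The Borel hierarchy along a well-order *)

Section Borel.
Context {d : Order.disp_t} {W : orderType d}.
Hypothesis wo : wochoice.well_order (<=%O : rel W).
Implicit Types a b : W.

Lemma well_order_min (P : set W) : P !=set0 ->
  exists2 m, P m & forall x, P x -> (m <= x)%O.
Proof.
move=> [x Px]; have [|m [[mP mmin] _]] := wo (A := [pred x | `[< P x >]]).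
  by exists x; apply/asboolP.
exists m; first exact/asboolP.
by move=> y Py; apply: mmin; apply/asboolP.
Qed.

Lemma well_order_ind (P : W -> Prop) :
  (forall a, (forall b, (b < a)%O -> P b) -> P a) -> forall a, P a.
Proof.
move=> Pind a; apply: contrapT => nPa.
have [m nPm mmin] := @well_order_min (~` P) (ex_intro _ a nPa).
apply: nPm; apply: Pind => b bm; apply: contrapT => /mmin.
by rewrite leNgt bm.
Qed.

(** The successive minima [z], [o], [t] are the ordinals 0, 1 and 2; the cases differ in how many of
    them are needed before [below a] is exhausted. The last one provides level 2 below [a]. *)
Lemma below_cases a : below a !=set0 ->
  [\/ below a #= `I_1, below a #= `I_2
    | `I_3 #<= below a /\
      exists2 b, (b < a)%O & below b #= `I_2].
Proof.
move=> [y0 y0a].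
have [z _ zmin] := @well_order_min setT (ex_intro _ a I).
have za : below a z by exact: le_lt_trans (zmin y0 I) y0a.
have [aE|] := pselect (below a `<=` [set z]).
  by apply: Or31; rewrite (_ : below a = [set z]) ?card_set1 // eqEsubset; split=> // _ ->.
move=> /existsNP[y /not_implyP[ya yz]].
have [o oz omin] := @well_order_min (~` [set z]) (ex_intro _ y yz).
have zo : (z < o)%O by rewrite lt_neqAle zmin // andbT; apply/eqP => zo; exact: oz.
have oa : below a o by exact: le_lt_trans (omin y yz) ya.
have card2 : [set z; o] #= `I_2.
  apply/eq_cardSP; exists o; first by right.
  rewrite (_ : _ `\` _ = [set z]) ?card_set1 // predeqE => x; split=> [[[]//]|->].
  by split; [left|move=> zE; move: zo; rewrite zE ltxx].
have [aE|] := pselect (below a `<=` [set z; o]).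
  apply: Or32; rewrite (_ : below a = [set z; o]) // eqEsubset; split=> //.
  by move=> _ [] ->.
move=> /existsNP[x /not_implyP[xa xzo]].
have [t tzo tmin] := @well_order_min (~` [set z; o]) (ex_intro _ x xzo).
have ta : below a t by exact: le_lt_trans (tmin x xzo) xa.
have zt : (z < t)%O by rewrite lt_neqAle zmin // andbT; apply/eqP => zt; apply: tzo; left.
have ot : (o < t)%O.
  rewrite lt_neqAle omin ?andbT; last by move=> tz; apply: tzo; left.
  by apply/eqP => ot; apply: tzo; right.
apply: Or33; split; last first.
  exists t => //; rewrite (_ : below t = [set z; o]) // eqEsubset; split.
    move=> u ut; apply: contrapT => /tmin; rewrite leNgt.
    by have -> : (u < t)%O by exact: ut.
  by move=> _ [] ->.
have card3 : [set z; o] `|` [set t] #= `I_3.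
  apply/eq_cardSP; exists t; first by right.
  rewrite (_ : _ `\` _ = [set z; o]) // predeqE => u; split=> [[[]//]|uzo].
  by split; [left|move=> ut; apply: tzo; rewrite -ut].
have : `I_3 #<= [set z; o] `|` [set t] by move: card3; rewrite card_eq_le => /andP[].
move=> /card_le_trans; apply; apply: subset_card_le.
by move=> _ [[] ->|->].
Qed.

Lemma card_ge_below_neq0 n a : `I_n.+1 #<= below a -> below a !=set0.
Proof.
by move=> an; apply/set0P/eqP => a0; move: an; rewrite a0 card_le0 => /eqP/predeqP/(_ 0) [/(_ isT)].
Qed.

Lemma below_ge2_cases a : `I_2 #<= below a ->
  below a #= `I_2 \/
    `I_3 #<= below a /\ exists2 b, (b < a)%O & below b #= `I_2.
Proof.
move=> a2; have [a1|?|?] := below_cases (card_ge_below_neq0 a2); [|by left|by right].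
by move: a2; rewrite (card_le_eqr a1) card_le_II.
Qed.

Lemma below_card_le n m a :
  below a #= `I_n -> `I_m #<= below a -> m <= n.
Proof. by move=> an; rewrite (card_le_eqr an) card_le_II. Qed.

Lemma card_ge_of_eq n a : below a #= `I_n -> `I_n #<= below a.
Proof. by rewrite card_eq_le => /andP[]. Qed.

Section Sigma0_levels.
Context {T : topologicalType}.
Implicit Types A B Q : set T.

Lemma Sigma0_below_neq0 a A : Sigma0 a A -> below a !=set0.
Proof.
case=> {a A} a A.
- by move=> /card_ge_of_eq/card_ge_below_neq0.
- by move=> /card_ge_of_eq/card_ge_below_neq0.
- by move=> b B /card_ge_below_neq0.
Qed.

(** Here and in the next two lemmas, the cardinality of [below a] rules out all constructors but
    one. *)
Lemma Sigma0_level1 a A : below a #= `I_1 -> Sigma0 a A -> open A.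
Proof.
move=> aP SA; case: SA aP => {a A} a A //.
  by move=> a2 _ /below_card_le/(_ (card_ge_of_eq a2)).
by move=> b B a3 _ _ _ /below_card_le/(_ a3).
Qed.

Lemma Sigma0_level2 a A : below a #= `I_2 -> Sigma0 a A -> Sigma02 A.
Proof.
move=> aP SA; case: SA aP => {a A} a A //.
  by move=> _ oA _; exact: Sigma02_open.
by move=> b B a3 _ _ _ /below_card_le/(_ a3).
Qed.

Lemma Sigma0_level3 a A : `I_3 #<= below a -> Sigma0 a A ->
  exists (b : nat -> W) (B : nat -> set T),
    [/\ forall n, (b n < a)%O, forall n, Sigma0 (b n) (~` B n)
      & A = \bigcup_n B n].
Proof.
move=> aP SA; case: SA aP => {a A} a A.
- by move=> a1 _ /(below_card_le a1).
- by move=> a1 _ /(below_card_le a1).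
- by move=> b B _ bn SB AE _; exists b, B.
Qed.

Lemma Sigma0_bigcup (I : countType) a (b : I -> W) (B : I -> set T) :
  `I_3 #<= below a -> (forall i, (b i < a)%O) ->
  (forall i, Sigma0 (b i) (~` B i)) -> Sigma0 a (\bigcup_i B i).
Proof.
move=> a3 ba SB.
(* Level 2 is given to the empty sets that pad the sequence at numbers decoding to no index. *)
have [c ca c2] : exists2 c, (c < a)%O & below c #= `I_2.
  have a2 : `I_2 #<= below a by apply: card_le_trans a3; rewrite card_le_II.
  have [a2'|[]//] := below_ge2_cases a2.
  by have := below_card_le a2' a3.
apply: (@is_Sigma0_gt2 _ _ _ _ _ (fun n => if unpickle n is Some i then b i else c)
  (fun n => if unpickle n is Some i then B i else set0)) => //.
- by move=> n; case: unpickle.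
- move=> n; case: unpickle => [i|]; first exact: SB.
  by apply: is_Sigma0_2 => //; rewrite setC0; exact/Sigma02_open/openT.
- rewrite predeqE => x; split=> [[i _ xi]|[n _]].
    by exists (pickle i) => //; rewrite pickleK.
  by case: (unpickle n) => [i xi|[]//]; exists i.
Qed.

(** Above level 2, the differences of open sets that make up [A] are pieces with complements of
    level 2. *)
Lemma Sigma02_Sigma0 a A : `I_2 #<= below a -> Sigma02 A -> Sigma0 a A.
Proof.
move=> /below_ge2_cases[a2|[a3 [c ca c2]]] SA; first exact: is_Sigma0_2.
have [U [V [oU oV ->]]] := SA.
apply: (@Sigma0_bigcup _ _ (fun=> c)) => // n.
by apply: is_Sigma0_2 => //; exact: Sigma02_setC_setD.
Qed.

Lemma open_Sigma0 a A : below a !=set0 -> open A -> Sigma0 a A.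
Proof.
move=> /below_cases[a1|a2|[a3 _]] oA; first exact: is_Sigma0_1.
  by apply: Sigma02_Sigma0; [exact: card_ge_of_eq|exact: Sigma02_open].
apply: Sigma02_Sigma0; last exact: Sigma02_open.
by apply: card_le_trans a3; rewrite card_le_II.
Qed.

Lemma Sigma0U_Sigma02 a A Q : `I_2 #<= below a ->
  Sigma0 a A -> Sigma02 Q -> Sigma0 a (A `|` Q).
Proof.
move=> /below_ge2_cases[a2|[a3 [c ca c2]]].
  by move=> /(Sigma0_level2 a2) SA SQ; apply: is_Sigma0_2 => //; exact: Sigma02U.
move=> /(Sigma0_level3 a3)[b [B [ba SB ->]]] [U [V [oU oV ->]]].
pose b' (i : nat + nat) := match i with inl n => b n | inr _ => c end.
pose B' (i : nat + nat) := match i with inl n => B n | inr n => U n `\` V n end.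
rewrite (_ : _ `|` _ = \bigcup_i B' i).
  apply: (@Sigma0_bigcup _ _ b') => // -[n|n] //=.
  by apply: is_Sigma0_2 => //; exact: Sigma02_setC_setD.
rewrite predeqE => x; split=> [[] [n _ xn]|[[] n _ xn]].
- by exists (inl n).
- by exists (inr n).
- by left; exists n.
- by right; exists n.
Qed.

Lemma Sigma0U_open a A Q : Sigma0 a A -> open Q -> Sigma0 a (A `|` Q).
Proof.
move=> SA oQ; have [a1|a2|[a3 _]] := below_cases (Sigma0_below_neq0 SA).
- by apply: is_Sigma0_1 => //; apply: openU => //; exact: Sigma0_level1 SA.
- by apply: Sigma0U_Sigma02 => //; [exact: card_ge_of_eq|exact: Sigma02_open].
- apply: Sigma0U_Sigma02 => //; last exact: Sigma02_open.
  by apply: card_le_trans a3; rewrite card_le_II.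
Qed.

(** Above level 2, intersecting a piece with [Q] enlarges its complement by an open set, which
    preserves the level of the piece even if that is 1. *)
Lemma Sigma0I_closed a A Q : `I_2 #<= below a ->
  Sigma0 a A -> open (~` Q) -> Sigma0 a (A `&` Q).
Proof.
move=> /below_ge2_cases[a2|[a3 _]].
  move=> /(Sigma0_level2 a2) SA oQ; apply: is_Sigma0_2 => //.
  by apply: Sigma02I => //; exact: Sigma02_closed.
move=> /(Sigma0_level3 a3)[b [B [ba SB ->]]] oQ.
rewrite setI_bigcupl; apply: (@Sigma0_bigcup _ _ b) => // n.
by rewrite setCI; exact: Sigma0U_open.
Qed.

End Sigma0_levels.

(** By induction on the derivation. The sets found for the pieces are right only on [S], which
    survives complements and unions because the conclusion is read on [S] as well. *)
Lemma Sigma0_preimage a : preimage_closed (Sigma0 a).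
Proof.
move=> Y T S h B hc; elim=> {a B} a B.
- move=> a1 oB; have [A oA AE] := within_continuous_open hc oB.
  by exists A => //; exact: is_Sigma0_1.
- move=> a2 SB; have [A SA AE] := Sigma02_preimage hc SB.
  by exists A => //; exact: is_Sigma0_2.
- move=> b C a3 ba _ IH ->.
  have /choice[A AP] n : exists A, Sigma0 (b n) A /\ S `&` h @^-1` (~` C n) = S `&` A.
    by have [A ? ?] := IH n; exists A.
  exists (\bigcup_n ~` A n).
    by apply: (@Sigma0_bigcup _ _ _ b) => // n; rewrite setCK; have [] := AP n.
  have CA n y : S y -> ~ C n (h y) <-> A n y.
    move=> Sy; have [_ /predeqP/(_ y) [E1 E2]] := AP n.
    by split=> ?; [case: E1|case: E2].
  rewrite predeqE => y; split=> -[Sy [n _]].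
    by move=> Cn; split=> //; exists n => // /CA; apply.
  move=> nA; split=> //; exists n => //; apply: contrapT => nC.
  by apply: nA; apply/CA.
Qed.

(* The levels below a are enumerated by r.  As the level of the n-th set is not
   known in advance, a code provides one set for every pair (i, n), of level r i,
   and all but one of the sets with second index n are empty. *)
Lemma universal_Sigma0 a (T : topologicalType) : @second_countable T ->
  countable (below a) -> below a !=set0 ->
  exists U : set (baire_space * T), universal (Sigma0 a) U.
Proof.
move=> cT; elim/well_order_ind: a => a IH ca a0.
have [a1|a2|[a3 [c cla c2]]] := below_cases a0.
- have [U [oU Uu]] := universal_open cT; exists U.
  by split; [exact: is_Sigma0_1|move=> A /(Sigma0_level1 a1)/Uu].
- have [U [SU Uu]] := universal_Sigma02 cT; exists U.
  by split; [exact: is_Sigma0_2|move=> A /(Sigma0_level2 a2)/Uu].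
(* Level 0 is left out: it contains no set, hence no universal one. *)
pose P := [set b | (b < a)%O /\ below b !=set0].
have Pc : P c by split=> //; exact: card_ge_below_neq0 (card_ge_of_eq c2).
have /choice[U UP] b : exists U, P b -> universal (@Sigma0 _ W b) (U : set (baire_space * T)).
  have [Pb|] := pselect (P b); last by exists set0.
  have cb : countable (below b).
    apply: sub_countable ca; apply: subset_card_le => x xb.
    exact: lt_trans xb Pb.1.
  by have [U UU] := IH b Pb.1 cb Pb.2; exists U.
have /countable_injP[f finj] := ca.
(* [r] inverts [f] on [P], with default [c] at the remaining indices. *)
have /choice[r rP] i : exists b, P b /\ forall b', P b' -> f b' = i -> b = b'.
  have [[b [Pb <-]]|nb] := pselect (exists b, P b /\ f b = i).
    exists b; split=> // b' Pb' fb; apply: finj; rewrite ?inE //.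
      exact: Pb.1.
    exact: Pb'.1.
  by exists c; split=> // b' Pb' fb; exfalso; apply: nb; exists b'.
have rf b : P b -> r (f b) = b by move=> Pb; have [_] := rP (f b); exact.
pose B (k : nat * nat) := ~` [set z : baire_space * T |
  U (r k.1) (column z.1 k, z.2)].
exists (\bigcup_k B k); split.
  apply: (@Sigma0_bigcup _ _ _ (fun k => r k.1)) => // k.
    by have [[]] := rP k.1.
  rewrite setCK; apply: preimage_closed_continuous.
  - exact: Sigma0_preimage.
  - exact: column_pair_continuous.
  - by have [Pk _] := rP k.1; have [] := UP _ Pk.
move=> A /(Sigma0_level3 a3)[b [C [ba SC ->]]].
have Pb n : P (b n) by split=> //; exact: Sigma0_below_neq0 (SC n).
pose D (k : nat * nat) := if r k.1 == b k.2 then C k.2 else set0.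
have /choice[e eP] k : exists e, ~` D k = [set x | U (r k.1) (e, x)].
  have [Pr _] := rP k.1; apply: (UP _ Pr).2; rewrite /D.
  case: eqP => [->//|_]; rewrite setC0.
  (* The complement of an empty entry is the whole space, which is open and so of every level but
     0. *)
  by apply: open_Sigma0; [exact: Pr.2|exact: openT].
have [p pe] := columns_surj e; exists p.
have BD k x : B k (p, x) <-> D k x.
  rewrite /B /= pe; have /predeqP/(_ x) /= [E1 E2] := eP k.
  by split=> [nU|Dk /E2]; [apply: contrapT => /E1|].
rewrite predeqE => x; split=> [[n _ Cn]|[k _ /BD]].
  by exists (f (b n), n) => //; apply/BD; rewrite /D /= rf // eqxx.
by rewrite /D; case: eqP => // _ ?; exists k.2.
Qed.

End Borel.

Theorem theorem5p5 :
  (forall (d : Order.disp_t) (W : orderType d) (a : W),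
     wochoice.well_order (<=%O : rel W) ->
     countable (below a) ->
     `I_2 #<= below a ->
     ~ (forall X : topologicalType, QCB0 (Sigma0 a) X -> QCB0 (Pi0 a) X))
  /\
  (forall n : nat, (0 < n)%N ->
     ~ (forall X : topologicalType, QCB0 (Sigma1 n) X -> QCB0 (Pi1 n) X)).
Proof.
split=> [d W a wo ca a2|n _].
  have [U Uu] := universal_Sigma0 wo baire_second_countable ca
    (card_ge_below_neq0 a2).
  apply: QCB0_not_sub_complement Uu.
  - exact: Sigma0_preimage.
  - by move=> B Q; exact: Sigma0U_Sigma02.
  - by move=> B C; exact: Sigma0I_closed.
have [U Uu] := universal_Sigma1 n baire_second_countable.
apply: QCB0_not_sub_complement Uu.
- by move=> Y T S h B; exact: Sigma1_preimage.
- by move=> B Q SB /(Sigma1UI_Sigma02 SB)[].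
- by move=> B C; exact: Sigma1I_closed.
Qed.
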